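(* Fix an integer $b\ge 2$ and let $\mathcal B_b=\{0,1,\dots,b-1\}\subset\mathcal N$. As $n\to\infty$, the proportion of degree $n$ polynomials in $\mathcal B_b[x]$ which are irreducible tends to $1$; that is, $$\lim_{n\to\infty}\frac{\#\{f\in\mathcal B_b[x]:\deg f=n,\ f\text{ irreducible}\}}{\#\{f\in\mathcal B_b[x]:\deg f=n\}}=1 .$$
   Context: Here $\mathbb N$ contains $0$. The max-min semiring is $\mathcal N=(\mathbb N\cup\{\infty\},\oplus,\otimes)$ with $a\oplus b=\max(a,b)$ and $a\otimes b=\min(a,b)$; its zero element is $0$. $\mathcal B_b=\{0,1,\dots,b-1\}$ is closed under both operations. Polynomials and formal power series over $\mathcal N$ (or $\mathcal B_b$) are added coefficientwise with $\oplus$ and multiplied by the usual convolution: if $f=\bigoplus_k\alpha_kx^k$ and $g=\bigoplus_k\beta_kx^k$, then the coefficient of $x^n$ in $fg=f\otimes g$ is $\bigoplus_{k=0}^n\alpha_k\otimes\beta_{n-k}=\max_{0\le k\le n}\min(\alpha_k,\beta_{n-k})$. The degree of a polynomial is the largest index of a nonzero coefficient. A monomial is an element with at most one nonzero coefficient, i.e. of the form $cx^k$. An element $f\in\mathcal N[[x]]$ is irreducible if $f=gh$ (with $g,h\in\mathcal N[[x]]$) implies that $g$ or $h$ is a monomial. *)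

(* Defs.v *)
From HB Require Import structures.
From mathcomp Require Import all_boot all_order all_algebra.
From mathcomp Require Import finmap.
From mathcomp Require Import all_classical all_reals all_analysis.

Set Implicit Arguments.
Unset Strict Implicit.
Unset Printing Implicit Defensive.

Import Order.TTheory GRing.Theory Num.Theory.
Import numFieldNormedType.Exports.

Local Open Scope classical_set_scope.
Local Open Scope ring_scope.

(* N u {oo}, carrying the max-min semiring structure below; since its ring
   operations are max and min, [+], [*], [\sum], [0] and [1] at this type mean
   max, min, iterated max, 0 and oo. *)
Inductive maxmin : Type := Fin of nat | Inf.

Definition option_of_maxmin (a : maxmin) : option nat :=
  if a is Fin m then Some m else None.
Definition maxmin_of_option (o : option nat) : maxmin :=
  if o is Some m then Fin m else Inf.
Lemma option_of_maxminK : cancel option_of_maxmin maxmin_of_option.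
Proof. by case. Qed.

HB.instance Definition _ := Countable.copy maxmin (can_type option_of_maxminK).

Definition mm_max (a c : maxmin) : maxmin :=
  match a, c with Fin m, Fin k => Fin (maxn m k) | _, _ => Inf end.

Definition mm_min (a c : maxmin) : maxmin :=
  match a, c with
  | Fin m, Fin k => Fin (minn m k)
  | Inf, _ => c
  | _, Inf => a
  end.

Lemma mm_maxA : associative mm_max.
Proof. by case=> [m|] [k|] [l|] //=; rewrite maxnA. Qed.
Lemma mm_maxC : commutative mm_max.
Proof. by case=> [m|] [k|] //=; rewrite maxnC. Qed.
Lemma mm_max0 : left_id (Fin 0) mm_max.
Proof. by case=> [m|] //=; rewrite max0n. Qed.
Lemma mm_minA : associative mm_min.
Proof. by case=> [m|] [k|] [l|] //=; rewrite minnA. Qed.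
Lemma mm_minC : commutative mm_min.
Proof. by case=> [m|] [k|] //=; rewrite minnC. Qed.
Lemma mm_minInf : left_id Inf mm_min.
Proof. by []. Qed.
Lemma mm_min_maxl : left_distributive mm_min mm_max.
Proof.
case=> [m|] [k|] [l|] //=; rewrite ?minn_maxl //; congr Fin.
  by rewrite (maxn_idPr _) // geq_minr.
by rewrite (maxn_idPl _) // geq_minr.
by rewrite maxnn.
Qed.
Lemma mm_min0 : left_zero (Fin 0) mm_min.
Proof. by case=> [m|] //=; rewrite min0n. Qed.
Lemma mm_Inf_neq0 : Inf != Fin 0.
Proof. by []. Qed.

HB.instance Definition _ :=
  GRing.isNmodule.Build maxmin mm_maxA mm_maxC mm_max0.
HB.instance Definition _ :=
  GRing.Nmodule_isComNzSemiRing.Build maxmin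
    mm_minA mm_minC mm_minInf mm_min_maxl mm_min0 mm_Inf_neq0.

Definition Bset (b : nat) : {pred maxmin} :=
  fun a => if a is Fin m then (m < b)%N else false.

(* The formal power series \sum_k (f k) x^k, represented by its coefficients. *)
Definition fps := nat -> maxmin.

Definition mul_fps (f g : fps) : fps :=
  fun n => \sum_(k < n.+1) f k * g (n - k)%N.

Definition monomial (f : fps) : Prop :=
  exists (c : maxmin) (k : nat), f = fun i => if i == k then c else 0.

Definition fps_irreducible (f : fps) : Prop :=
  forall g h : fps, f = mul_fps g h -> monomial g \/ monomial h.

Definition fps_of_poly (f : {poly maxmin}) : fps := fun k => f`_k.

(* Polynomials over Bset b of degree n: [size] is one more than the degree. *)
Definition polys_of_degree (b n : nat) : set {poly maxmin} :=
  [set f | (forall i, f`_i \in Bset b) /\ size f = n.+1].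

Definition irreducible_polys_of_degree (b n : nat) : set {poly maxmin} :=
  [set f | polys_of_degree b n f /\ fps_irreducible (fps_of_poly f)].

(* [fset_set] is meaningful only on finite sets. *)
Lemma finite_polys_of_degree (b n : nat) : finite_set (polys_of_degree b n).
Proof.
pose F (t : {ffun 'I_n.+1 -> 'I_b}) : {poly maxmin} :=
  \poly_(i < n.+1) (if insub i is Some j then Fin (t j) else 0).
apply: (@sub_finite_set _ _ (F @` setT)); last first.
  by apply: finite_image; exact: finite_finset.
move=> f [fB sf].
have lt_b (j : 'I_n.+1) : (odflt 0%N (option_of_maxmin (f`_j)%R) < b)%N.
  by have := fB j; rewrite unfold_in /Bset; case: (f`_j).
exists [ffun j => Ordinal (lt_b j)] => //.
apply/polyP => i; rewrite coef_poly; case: ltnP => [lt_i|le_i]; last first.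
  by rewrite nth_default // sf.
rewrite insubT ffunE /=.
by have := fB i; rewrite unfold_in /Bset; case: (f`_i).
Qed.

Lemma finite_irreducible_polys_of_degree (b n : nat) :
  finite_set (irreducible_polys_of_degree b n).
Proof.
by apply: sub_finite_set (finite_polys_of_degree b n) => f [].
Qed.

(* Main.v *)
(** Take the coefficients of f in degree at most n uniformly at random and let
A be the support of f.  If f = g h with neither factor a monomial, then
A = B + C, where B and C are the supports of g and h and have at least two
elements.  With k about n^(1/20), two cases are excluded by union bounds.

If |B| and |C| exceed k^3, there are B0 in B and C0 in C of size k whose k^2
pairwise sums are distinct; all of them lie in A, and the expected number of
such pairs is at most n^(2k) p^(k^2), where p is the probability that a given
coefficient is nonzero.

If 2 <= |C| <= k^3, every a in A lies in a translate of C contained in A.  For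
a fixed C, this fails at a given a with probability bounded below independently
of n, a and C, and it only depends on A near a, on the block a + C - C.  There
are k^8 positions with disjoint blocks, so the expected number of such C is at
most n^(k^3) y^(k^8) for a constant y < 1. *)
Require Import Defs.
From HB Require Import structures.
From mathcomp Require Import all_boot all_order all_algebra.
From mathcomp Require Import finmap.
From mathcomp Require Import all_classical all_reals all_analysis.
From mathcomp Require Import lra.

Set Implicit Arguments.
Unset Strict Implicit.
Unset Printing Implicit Defensive.

Import Order.TTheory GRing.Theory Num.Theory.
Import numFieldNormedType.Exports.

(** * Union bounds and greedy selection in finite sets *)

Lemma leq_card_bigcup (I : Type) (T : finType) (s : seq I) (P : pred I)
    (F : I -> {set T}) :
  (#|\bigcup_(i <- s | P i) F i| <= \sum_(i <- s | P i) #|F i|)%SET%N.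
Proof.
elim/big_rec2: _ => [|i m A _ leA]; first by rewrite cards0.
by apply: leq_trans (leq_card_setU _ _) _; rewrite leq_add2l.
Qed.

(** Each chosen element rules out at most [d] candidates, so after fewer than [m] choices some
    element of [A] is still allowed. This selects positions with disjoint blocks as well as summands
    without coinciding sums. *)
Lemma greedy_pairwise (T : finType) (r : rel T) (A : {set T}) (d m : nat) :
  reflexive r -> (0 < d)%N -> (forall x, #|[set y | r x y]%SET| <= d)%N ->
  (m * d <= #|A|)%N ->
  exists s : seq T,
    [/\ size s = m, {subset s <= A} & pairwise (fun x y => ~~ r y x) s].
Proof.
move=> rr d_gt0 rd; elim: m => [|m IHm] leA; first by exists [::].
have [|s [sz sA ps]] := IHm; first by apply: leq_trans leA; rewrite leq_mul.
pose U := (\bigcup_(x in s) [set y | r x y])%SET.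
have leU : (#|U| <= m * d)%N.
  apply: leq_trans (leq_card_bigcup _ _ _) _.
  apply: leq_trans (leq_sum _ (fun x _ => rd x)) _.
  by rewrite sum_nat_const -sz leq_mul2r card_size orbT.
have [x xA xU] : exists2 x, x \in A & x \notin U.
  apply/subsetPn/negP => /subset_leq_card AU.
  have := leq_trans leA (leq_trans AU leU).
  by rewrite leq_mul2r ltnn orbF eqn0Ngt d_gt0.
exists (x :: s); split=> /=; first by rewrite sz.
- by move=> y; rewrite inE => /predU1P[->|/sA].
rewrite ps andbT; apply/allP => y ys; apply: contra xU => ryx.
by apply/bigcupP; exists y => //; rewrite inE.
Qed.

Lemma pairwise_sym_in (T : eqType) (r : rel T) (s : seq T) :
  symmetric r -> pairwise r s -> {in s &, forall x y, x != y -> r x y}.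
Proof.
move=> rC; elim: s => //= z s IHs /andP[/allP rz ps] x y; rewrite !inE.
case/predU1P=> [->|xs] /predU1P[->|ys]; rewrite ?eqxx // => xy.
- exact: rz.
- by rewrite rC rz.
- exact: IHs.
Qed.

(** Such a set is listed by an [S]-tuple that repeats one of its elements as padding; nonemptiness
    supplies that element. *)
Lemma card_small_sets (T : finType) (S : nat) :
  (#|[set A : {set T} | 0 < #|A| <= S]%SET| <= #|T| ^ S)%N.
Proof.
apply: (@leq_trans #|[set [set x in val t] | t in [set: S.-tuple T]]%SET|).
  apply/subset_leq_card/fintype.subsetP => A.
  rewrite inE => /andP[/card_gt0P[x xA] leS].
  have sz : size (enum A ++ nseq (S - #|A|) x) == S.
    by rewrite size_cat size_nseq -cardE subnKC.
  apply/imsetP; exists (Tuple sz); rewrite ?inE //.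
  apply/setP => y; rewrite inE mem_cat mem_enum mem_nseq.
  by case: eqP => [->|]; rewrite ?xA ?andbF ?orbF.
by apply: leq_trans (leq_imset_card _ _) _; rewrite cardsT card_tuple.
Qed.

(** * Uniform probability on a finite space of functions *)

Section Probability.
Variables (R : realFieldType) (I T : finType) (t0 : T).
Local Open Scope ring_scope.
Local Notation F := {ffun I -> T}.
Implicit Types (E : pred F) (D : {set I}) (f g : F).

Definition pr E : R := #|E|%:R / #|{: F}|%:R.

Definition depends_on D E := forall f g, {in D, f =1 g} -> E f = E g.

Lemma card_ffun_gt0 : 0 < #|{: F}|%:R :> R.
Proof. by rewrite ltr0n; apply/card_gt0P; exists [ffun=> t0]. Qed.

Lemma pr_ge0 E : 0 <= pr E.
Proof. exact: divr_ge0. Qed.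

Lemma sub_pr E1 E2 : (forall f, E1 f -> E2 f) -> pr E1 <= pr E2.
Proof.
move=> sE; rewrite ler_wpM2r ?invr_ge0 // ler_nat.
exact/subset_leq_card/fintype.subsetP.
Qed.

Lemma eq_pr E1 E2 : E1 =1 E2 -> pr E1 = pr E2.
Proof. by move=> eE; rewrite /pr (eq_card eE). Qed.

Lemma prT : pr xpredT = 1.
Proof. by rewrite /pr divff ?gt_eqF ?card_ffun_gt0. Qed.

Lemma pr_pred0 : pr xpred0 = 0.
Proof. by rewrite /pr eq_card0 ?mul0r. Qed.

Lemma pr_union (J : finType) (A : {set J}) (P : J -> pred F) (x : R) :
  (forall j, j \in A -> pr (P j) <= x) ->
  pr (fun f => [exists j in A, P j f]) <= #|A|%:R * x.
Proof.
move=> leP; apply: (@le_trans _ _ (\sum_(j in A) pr (P j))); last first.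
  by rewrite -sumr_const big_distrl /= ler_sum // => j jA; rewrite mul1r leP.
rewrite -big_distrl /= ler_wpM2r ?invr_ge0 // -natr_sum ler_nat.
apply: leq_trans (leq_trans _ (leq_card_bigcup _ (mem A)
  (fun j => [set f | P j f]%SET))) _.
  apply/subset_leq_card/fintype.subsetP => f /exists_inP[j jA Pj].
  by apply/bigcupP; exists j; rewrite // inE.
by rewrite leq_eqVlt; apply/orP; left; apply/eqP/eq_bigr => j _; rewrite cardsE.
Qed.

Lemma prU E1 E2 : pr (fun f => E1 f || E2 f) <= pr E1 + pr E2.
Proof.
rewrite -mulrDl -natrD ler_wpM2r ?invr_ge0 // ler_nat.
by rewrite (@eq_card _ _ [predU E1 & E2]) // -cardUI leq_addr.
Qed.

Lemma prC E : pr (fun f => ~~ E f) = 1 - pr E.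
Proof.
apply/eqP; rewrite eq_sym subr_eq -mulrDl -natrD addnC.
rewrite (@eq_card _ (fun f => ~~ E f) [predC E]) // cardC divff //.
by rewrite gt_eqF ?card_ffun_gt0.
Qed.

Lemma pr_family (G : I -> pred T) :
  pr (fun f => [forall i, G i (f i)]) = \prod_i (#|G i|%:R / #|T|%:R).
Proof.
rewrite big_split /= prodfV prodr_const -natr_prod -natrX /pr card_ffun.
rewrite (@eq_card _ _ (family G)); last by move=> f.
by rewrite card_family foldrE big_image.
Qed.

(* Exchanging the coordinates in D of f and g is an involution on pairs. *)
Lemma pr_indep D E1 E2 : depends_on D E1 -> depends_on (~: D)%SET E2 ->
  pr (fun f => E1 f && E2 f) = pr E1 * pr E2.
Proof.
move=> dE1 dE2.
pose mix f g : F := [ffun i => if i \in D then f i else g i].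
pose sw (u : F * F) := (mix u.1 u.2, mix u.2 u.1).
have swK : involutive sw.
  move=> [f g]; rewrite /sw /=.
  by congr (_, _); apply/ffunP => i; rewrite /mix !ffunE; case: ifP => ->.
have Esw f g : E1 f && E2 f = E1 (sw (f, g)).1 && E2 (sw (f, g)).2.
  rewrite (dE1 f (mix f g)); last by move=> i iD; rewrite ffunE iD.
  rewrite (dE2 f (mix g f)) // => i; rewrite inE => /negbTE iD.
  by rewrite ffunE iD.
rewrite /pr mulf_div -natrM.
have -> : (#|E1| * #|E2| = #|fun f => E1 f && E2 f| * #|{: F}|)%N.
  rewrite -!cardX -(fintype.card_image (inv_inj swK)); apply: eq_card => u.
  rewrite -{1}[u]swK fintype.mem_image ?inE; last exact: inv_inj.
  by case: u => f g; rewrite andbT; rewrite [RHS](Esw f g).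
rewrite natrM -mulf_div divff ?mulr1 //.
by rewrite gt_eqF ?card_ffun_gt0.
Qed.

(** By disjointness, the events after the head of [s] depend only on coordinates outside the head's
    set, so [pr_indep] splits off one factor at a time. *)
Lemma pr_indep_seq (J : eqType) (P : J -> pred F) (D : J -> {set I}) (x : R)
    (s : seq J) :
  0 <= x -> (forall j, depends_on (D j) (P j)) -> (forall j, pr (P j) <= x) ->
  pairwise (fun i j => [disjoint D i & D j]) s ->
  pr (fun f => all (fun j => P j f) s) <= x ^+ size s.
Proof.
move=> x0 dP leP; elim: s => [|j s IHs] /=; first by rewrite prT.
case/andP=> dj ps; rewrite (pr_indep (D := D j)) //.
  by rewrite exprS ler_pM ?pr_ge0 ?IHs.
move=> f g fg; apply: eq_in_all => i si; apply: dP => y yi; apply: fg.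
by rewrite inE (disjointFl (allP dj _ si)).
Qed.

End Probability.
Arguments eq_pr {R I T E1 E2}.
Arguments sub_pr {R I T E1 E2}.
Arguments prU {R I T}.
Arguments pr_family {R I T}.

(** * Random supports and their decompositions as sumsets *)

Section RandomSupport.
Variables (R : realFieldType) (T : finType) (t0 : T) (n : nat).
Hypothesis T_gt1 : (1 < #|T|)%N.
Local Open Scope ring_scope.
Local Notation F := {ffun 'I_n.+1 -> T}.
Implicit Types (f g : F) (B C D : {set 'I_n.+1}) (a i : 'I_n.+1).

(** Defined on all naturals because a sum of two positions can exceed [n]; the bound guards against
    [inord] sending such a sum to a default position. *)
Definition in_supp f (x : nat) : bool := (x < n.+1)%N && (f (inord x) != t0).

Definition pnz : R := #|predC1 t0|%:R / #|T|%:R.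
Local Notation p := pnz.
Local Notation pr := (@pr R 'I_n.+1 T).

Lemma cardT_gt0 : 0 < #|T|%:R :> R.
Proof. by rewrite ltr0n ltnW. Qed.

Lemma cardT_div : #|T|%:R / #|T|%:R = 1 :> R.
Proof. by rewrite divff // gt_eqF ?cardT_gt0. Qed.

Lemma pnzC : 1 - p = #|pred1 t0|%:R / #|T|%:R.
Proof.
apply/eqP; rewrite subr_eq -mulrDl -natrD (cardC (pred1 t0)) divff //.
by rewrite gt_eqF ?cardT_gt0.
Qed.

Lemma pnz_gt0 : 0 < p.
Proof. by rewrite divr_gt0 ?cardT_gt0 // ltr0n cardC1 -subn1 subn_gt0. Qed.

Lemma pnz_lt1 : p < 1.
Proof. by rewrite -subr_gt0 pnzC divr_gt0 ?cardT_gt0 // card1. Qed.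

Lemma pr_supp D m : (m <= #|D|)%N ->
  pr (fun f => [forall i in D, f i != t0]) <= p ^+ m.
Proof.
move=> leD; rewrite (pr_family (fun i t => (i \in D) ==> (t != t0))).
rewrite (bigID (mem D)) /= [X in _ * X]big1 => [|i iD]; last first.
  rewrite (@eq_card _ _ predT) ?cardT_div // => t.
  by rewrite !inE /= unfold_in (negbTE iD).
rewrite mulr1 (eq_bigr (fun=> p)) => [|i iD]; last first.
  by congr (_%:R / _); apply: eq_card => t; rewrite !inE unfold_in iD.
rewrite prodr_const ler_wiXn2l //; first exact: ltW pnz_gt0.
exact: ltW pnz_lt1.
Qed.

Lemma pr_coord0 a : pr (fun f => f a == t0) = 1 - p.
Proof.
rewrite pnzC (eq_pr (E2 := fun f =>
  [forall i, (i == a) ==> (f i == t0)])) => [|f]; last first.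
  apply/idP/forallP => [fa i|/(_ a)]; last by rewrite eqxx.
  by apply/implyP => /eqP->.
rewrite (pr_family (fun i t => (i == a) ==> (t == t0))).
rewrite (bigD1 a) //= [X in _ * X]big1 => [|i ia].
  rewrite mulr1; congr (_%:R / _); apply: eq_card => t.
  by rewrite !inE unfold_in eqxx.
rewrite (@eq_card _ _ predT) ?cardT_div // => t.
by rewrite !inE unfold_in (negbTE ia).
Qed.

(* When supp f = B + C, the translate of C witnessing a \in supp f lies
   entirely in supp f. *)
Definition tiled C a f : bool :=
  (f a == t0) ||
  [exists c in C, (c <= a)%N && [forall c' in C, in_supp f (a - c + c')]].

(** This is [a + C - C] within the range up to [n], written additively to avoid truncated
    subtraction. *)
Definition block C a : {set 'I_n.+1} :=
  [set i : 'I_n.+1 | [exists c in C, [exists c' in C, (c + i == a + c')%N]]]%SET.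

Lemma blockP C a i :
  reflect (exists c c', [/\ c \in C, c' \in C & (c + i = a + c')%N])
  (i \in block C a).
Proof.
rewrite inE; apply: (iffP exists_inP) => [[c cC /exists_inP[c' c'C /eqP e]]|].
  by exists c, c'.
case=> c [c' [cC c'C e]]; exists c => //.
by apply/exists_inP; exists c' => //; apply/eqP.
Qed.

Lemma card_block C a : (#|block C a| <= #|C| ^ 2)%N.
Proof.
rewrite -mulnn -cardsX.
pose F (u : 'I_n.+1 * 'I_n.+1) : 'I_n.+1 := inord (a + u.2 - u.1).
apply: leq_trans (leq_imset_card F _).
apply/subset_leq_card/fintype.subsetP => i /blockP[c [c' [cC c'C e]]].
by apply/imsetP; exists (c, c'); rewrite ?inE ?cC /F //= -e addKn inord_val.
Qed.

Lemma block_sym C a i : (i \in block C a) = (a \in block C i).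
Proof.
by apply/blockP/blockP => -[c [c' [cC c'C e]]]; exists c', c; split=> //;
  rewrite addnC -e addnC.
Qed.

Lemma block_refl C a : (0 < #|C|)%N -> a \in block C a.
Proof.
by case/card_gt0P=> c cC; apply/blockP; exists c, c; rewrite addnC.
Qed.

(** The event inspects only [a] and positions [a - c + c'] with [c] and [c'] in [C]; [a] itself is
    the case [c = c']. *)
Lemma tiled_depends C a : (0 < #|C|)%N -> depends_on (block C a) (tiled C a).
Proof.
move=> C0 f g fg; rewrite /tiled fg ?block_refl //; congr (_ || _).
apply: eq_existsb => c; case cC: (c \in C) => //=; case: leqP => //= ca.
apply: eq_forallb => c'; case c'C: (c' \in C) => //=; rewrite /in_supp.
case: ltnP => //= lt; rewrite fg //; apply/blockP; exists c, c'; split=> //.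
by rewrite inordK // addnA subnKC.
Qed.

(** Union bound over a zero coefficient at [a] and the translates of [C] through [a], at most one
    for each [c]. It is effective for large [C]. *)
Lemma pr_tiled_le C a : pr (tiled C a) <= 1 - p + #|C|%:R * p ^+ #|C|.
Proof.
apply: le_trans (prU _ _) _; rewrite pr_coord0 lerD2l.
apply: pr_union => c cC.
(* A translate reaching beyond [n] never lies in the support; any other one consists of [#|C|]
   distinct positions. *)
have [ltC|] := boolP [forall c' in C, (a - c + c' < n.+1)%N]; last first.
  move/forall_inPn => [c' c'C nlt].
  rewrite (eq_pr (E2 := xpred0)).
    by rewrite pr_pred0 exprn_ge0 // ltW ?pnz_gt0.
  move=> f; apply/negbTE; rewrite negb_and orbC.
  apply/orP; left; apply/forall_inPn; exists c' => //.
  by rewrite /in_supp (negbTE nlt).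
pose D : {set 'I_n.+1} := [set inord (a - c + c')%N | c' : 'I_n.+1 in C]%SET.
have cD : #|D| = #|C|.
  apply: card_in_imset => x y xC yC /(congr1 val) /=.
  by rewrite !inordK ?(forall_inP ltC) // => /addnI/val_inj.
apply: le_trans (pr_supp (D := D) _); last by rewrite cD.
apply: sub_pr => f /andP[_ /forall_inP h].
apply/forall_inP => i /imsetP[c' c'C ->].
by have /andP[] := h _ c'C.
Qed.

(** Tiling fails at [a] when [f a] is nonzero and [f] vanishes on the rest of the block: every
    translate of [C] through [a] has a second point, which lies in the block. This serves small [C],
    where [pr_tiled_le] can exceed 1. *)
Lemma pr_tiled_le_small C a : (1 < #|C|)%N ->
  pr (tiled C a) <= 1 - p * (1 - p) ^+ (#|C| ^ 2).
Proof.
move=> C1.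
pose G i t := if i == a then t != t0 else (i \in block C a) ==> (t == t0).
rewrite lerBrDr -lerBrDl -prC //.
apply: (@le_trans _ _ (pr (fun f => [forall i, G i (f i)]))); last first.
  apply: sub_pr => f /forallP Gf; rewrite negb_or.
  have := Gf a; rewrite /G eqxx => -> /=.
  apply/exists_inPn => c cC; rewrite negb_and -implybE; apply/implyP => ca.
  have [c' c'C c'c] : exists2 c', c' \in C & c' != c.
    have /card_gt0P[c'] : (0 < #|C :\ c|%SET)%N by rewrite (cardsD1 c) cC in C1.
    by rewrite !inE => /andP[]; exists c'.
  apply/forall_inPn; exists c' => //; apply/negP => /andP[lt].
  have := Gf (inord (a - c + c')); rewrite /G ifN.
    move=> /implyP-> //; apply/blockP; exists c, c'; split=> //.
    by rewrite inordK // addnA subnKC.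
  apply: contra c'c => /eqP/(congr1 val) /=; rewrite inordK // => e.
  by rewrite -val_eqE /= -(eqn_add2l (a - c)) e subnK.
rewrite pr_family (bigD1 a) //=; apply: ler_pM.
- exact: ltW pnz_gt0.
- by rewrite exprn_ge0 // subr_ge0 ltW ?pnz_lt1.
- by rewrite ler_wpM2r ?invr_ge0 // ler_nat; apply: subset_leq_card;
    apply/fintype.subsetP => t; rewrite /G !inE unfold_in eqxx.
have q0 : 0 <= 1 - p by rewrite subr_ge0 ltW ?pnz_lt1.
have q1 : 1 - p <= 1 by rewrite lerBlDr lerDl ltW ?pnz_gt0.
rewrite (bigID (mem (block C a))) /=.
rewrite [X in _ * X]big1 => [|i /andP[ia iB]]; last first.
  rewrite (@eq_card _ _ predT) ?cardT_div // => t.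
  by rewrite !inE /G unfold_in (negbTE ia) (negbTE iB).
rewrite mulr1 (eq_bigr (fun=> 1 - p)) => [|i /andP[ia iB]]; last first.
  rewrite pnzC; congr (_%:R / _); apply: eq_card => t.
  by rewrite !inE /G unfold_in (negbTE ia) iB.
rewrite prodr_const ler_wiXn2l //.
apply: leq_trans (card_block C a); apply: subset_leq_card.
by apply/fintype.subsetP => i; rewrite unfold_in => /andP[].
Qed.

(** Greedy selection yields [m] positions whose blocks are pairwise disjoint, and the tiling events
    there are independent. *)
Lemma pr_all_tiled_le C (m : nat) (x : R) : 0 <= x -> (0 < #|C|)%N ->
    (forall a, pr (tiled C a) <= x) -> (m * #|C| ^ 4 <= n.+1)%N ->
  pr (fun f => [forall a, tiled C a f]) <= x ^+ m.
Proof.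
move=> x0 C0 lex lem.
pose r : rel 'I_n.+1 := fun a a' => ~~ [disjoint block C a & block C a'].
have rr : reflexive r.
  by move=> a; apply/pred0Pn; exists a; rewrite /= !block_refl.
(* If two blocks share [y], then [a'] lies in the block of [y] and [y] in the block of [a], which
   leaves at most [#|C| ^ 2] times [#|C| ^ 2] choices of [a']. *)
have rd a : (#|[set a' | r a a']%SET| <= #|C| ^ 4)%N.
  apply: (@leq_trans #|(\bigcup_(x in block C a) block C x)%SET|).
    apply/subset_leq_card/fintype.subsetP => a'.
    rewrite inE => /pred0Pn[y /= /andP[ya ya']].
    by apply/bigcupP; exists y; rewrite // block_sym.
  apply: leq_trans (leq_card_bigcup _ _ _) _.
  apply: leq_trans (leq_sum _ (fun x _ => card_block C x)) _.
  by rewrite sum_nat_const -[4%N]/(2 + 2)%N expnD leq_mul2r card_block orbT.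
have [||s [sz _ ps]] :=
  greedy_pairwise (A := [set: 'I_n.+1]%SET) (m := m) rr _ rd.
- by rewrite expn_gt0 C0.
- by rewrite cardsT card_ord.
rewrite -sz.
apply: le_trans (pr_indep_seq (P := tiled C) (D := block C) t0 _ _ lex _) => //.
- by apply: sub_pr => f /forallP h; apply/allP.
- by move=> a; apply: tiled_depends.
by apply: sub_pairwise ps => a a'; rewrite negbK disjoint_sym.
Qed.

Definition supp_sumset f B C : bool :=
  [forall b in B, [forall c in C, in_supp f (b + c)]] &&
  [forall x, (f x != t0) ==>
     [exists b in B, [exists c in C, (x == b + c :> nat)%N]]].

Lemma supp_sumsetP f B C : reflect
  [/\ {in B & C, forall b c : 'I_n.+1, in_supp f (b + c)} &
      forall x : 'I_n.+1, f x != t0 ->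
        exists b c : 'I_n.+1, [/\ b \in B, c \in C & x = b + c :> nat]%N]
  (supp_sumset f B C).
Proof.
apply: (iffP andP) => -[h1 h2]; split.
- by move=> b c bB cC; apply: (forall_inP (forall_inP h1 b bB)).
- move=> x /(implyP (forallP h2 x)).
  move=> /exists_inP[b bB /exists_inP[c cC /eqP e]].
  by exists b, c.
- by apply/forall_inP => b bB; apply/forall_inP => c cC; apply: h1.
- apply/forallP => x; apply/implyP => /h2[b [c [bB cC e]]].
  apply/exists_inP; exists b => //; apply/exists_inP; exists c => //.
  exact/eqP.
Qed.

Lemma supp_sumsetC f B C : supp_sumset f B C -> supp_sumset f C B.
Proof.
case/supp_sumsetP=> h1 h2; apply/supp_sumsetP; split=> [c b cC bB|x].
  by rewrite addnC h1.
by case/h2=> b [c [bB cC e]]; exists c, b; rewrite addnC.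
Qed.

Lemma supp_sumset_tiled f B C a : supp_sumset f B C -> tiled C a f.
Proof.
case/supp_sumsetP=> h1 h2; rewrite /tiled.
case: eqVneq => //= /h2[b [c [bB cC e]]]; apply/exists_inP; exists c => //.
by rewrite e leq_addl addnK; apply/forall_inP => c' c'C; apply: h1.
Qed.

(** Sums beyond [n] are sent to a default position; none occurs for subsets of the summands of a
    support. *)
Definition sumset B C : {set 'I_n.+1} :=
  [set inord (u.1 + u.2) | u : 'I_n.+1 * 'I_n.+1 in finset.setX B C]%SET.

(** Fix any [k] elements of [B] as [B0] and pick elements of [C] greedily so that no difference of
    two of them is a difference in [B0]. Each pick [c] excludes only its block [c + B0 - B0], of
    size at most [k ^ 2], so [k ^ 3] elements suffice, and two equal sums would violate the
    choice. *)
Lemma supp_sumset_grid f B C k : supp_sumset f B C -> (0 < k)%N ->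
    (k <= #|B|)%N -> (k ^ 3 <= #|C|)%N ->
  exists B0 C0 : {set 'I_n.+1},
    [/\ #|B0| = k, #|C0| = k, #|sumset B0 C0| = (k ^ 2)%N
      & [forall i in sumset B0 C0, f i != t0]].
Proof.
case/supp_sumsetP=> h1 h2 k0 /card_geqP[s [us szs sB]] leC.
pose B0 : {set 'I_n.+1} := [set x in s]%SET.
have cB0 : #|B0| = k by rewrite cardsE (card_uniqP us).
have B0_gt0 : (0 < #|B0|)%N by rewrite cB0.
pose r : rel 'I_n.+1 := fun c c' => c' \in block B0 c.
have rd c : (#|[set c' | r c c']%SET| <= k ^ 2)%N.
  by rewrite -cB0 (leq_trans _ (card_block B0 c)) // subset_leq_card //;
    apply/fintype.subsetP => c'; rewrite inE.
have [|||t [szt tC pt]] := greedy_pairwise (A := C) (m := k) _ _ rd.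
- by move=> c; apply: block_refl.
- by rewrite expn_gt0 k0.
- by rewrite -expnS.
have ut : uniq t.
  rewrite uniq_pairwise; apply: sub_pairwise pt => c c' /=.
  apply: contraNneq => ->.
  exact: block_refl.
have rt := pairwise_sym_in _ pt.
exists B0, [set x in t]%SET.
have cC0 : #|[set x in t]%SET| = k by rewrite cardsE (card_uniqP ut).
have h x y : x \in s -> y \in t -> in_supp f (x + y).
  by move=> xs yt; apply: h1; [apply: sB | apply: tC].
split=> //.
  rewrite card_in_imset ?cardsX ?cB0 ?cC0 //.
  move=> [x y] [x' y']; rewrite !inE /= => /andP[xs yt] /andP[xs' yt'].
  have /andP[lt _] := h _ _ xs yt; have /andP[lt' _] := h _ _ xs' yt'.
  move/(congr1 val); rewrite /= !inordK // => e.
  have [yy'|yy'] := eqVneq y y'.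
    by move: e; rewrite yy' => /addIn/val_inj->.
  have rC (z z' : 'I_n.+1) := congr1 negb (block_sym B0 z' z).
  have /negP[] := rt rC _ _ yt yt' yy'.
  by apply/blockP; exists x, x'; rewrite !inE [(y' + _)%N]addnC.
apply/forall_inP => i /imsetP[[x y]]; rewrite !inE /= => /andP[xs yt] ->.
by have /andP[] := h _ _ xs yt.
Qed.

Definition decomposable f : bool :=
  [exists B : {set 'I_n.+1}, [exists C : {set 'I_n.+1},
    [&& (1 < #|B|)%N, (1 < #|C|)%N & supp_sumset f B C]]].

Lemma pr_decomposable_le k (x : R) :
    (0 < k)%N -> (k ^ 20 <= n.+1)%N -> 0 <= x ->
    (forall C a, (1 < #|C|)%N -> pr (tiled C a) <= x) ->
  pr decomposable <=
    (n.+1%:R ^+ (k ^ 3)) * x ^+ (k ^ 8) + n.+1%:R ^+ (k + k) * p ^+ (k ^ 2).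
Proof.
move=> k0 lek x0 lex.
pose U := [set C : {set 'I_n.+1} | (1 < #|C| <= k ^ 3)%N]%SET.
(* The upper bounds on sizes limit the number of pairs, while the lower bound on the sumset gives
   the exponent of [p]. *)
pose V := [set u : {set 'I_n.+1} * {set 'I_n.+1} |
  [&& (0 < #|u.1| <= k)%N, (0 < #|u.2| <= k)%N &
      (k ^ 2 <= #|sumset u.1 u.2|)%N]]%SET.
have leU : (#|U| <= n.+1 ^ (k ^ 3))%N.
  have := card_small_sets 'I_n.+1 (k ^ 3); rewrite card_ord; apply: leq_trans.
  apply/subset_leq_card/fintype.subsetP => C; rewrite !inE => /andP[C1 ->].
  by rewrite ltnW.
have leV : (#|V| <= n.+1 ^ (k + k))%N.
  have lek' := card_small_sets 'I_n.+1 k; rewrite card_ord in lek'.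
  rewrite expnD; apply: leq_trans (leq_mul lek' lek'); rewrite -cardsX.
  apply/subset_leq_card/fintype.subsetP => -[B C].
  by rewrite !inE /= => /and3P[-> ->].
pose E1 f := [exists C in U, [forall a, tiled C a f]].
pose E2 f := [exists u in V, [forall i in sumset u.1 u.2, f i != t0]].
apply: (@le_trans _ _ (pr (fun f => E1 f || E2 f))).
  apply: sub_pr => f /existsP[B /existsP[C /and3P[B1 C1 fBC]]].
  case: (leqP #|C| (k ^ 3)) => leC.
    apply/orP; left; apply/exists_inP; exists C; first by rewrite inE C1.
    by apply/forallP => a; apply: supp_sumset_tiled fBC.
  (* If [B] is the small summand, commutativity lets it play the role of [C]. *)
  case: (leqP #|B| (k ^ 3)) => leB.
    apply/orP; left; apply/exists_inP; exists B; first by rewrite inE B1.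
    by apply/forallP => a; apply: supp_sumset_tiled (supp_sumsetC fBC).
  apply/orP; right.
  have [||B0 [C0 [cB0 cC0 cBC fBC0]]] := supp_sumset_grid fBC k0.
  - by rewrite ltnW // (leq_ltn_trans _ leB) // -[leqLHS]expn1 leq_pexp2l.
  - exact: ltnW.
  apply/exists_inP; exists (B0, C0) => //.
  by rewrite inE /= cB0 cC0 cBC k0 !leqnn.
apply: le_trans (prU _ _) (lerD _ _).
  have leP C : C \in U -> pr (fun f => [forall a, tiled C a f]) <= x ^+ (k ^ 8).
    rewrite inE => /andP[C1 leC]; apply: pr_all_tiled_le => //.
    - exact: ltnW.
    - by move=> a; apply: lex.
    (* As [#|C| <= k ^ 3], there is room for [k ^ 8] disjoint blocks:
       [k ^ 8 * (k ^ 3) ^ 4 = k ^ 20]. *)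
    apply: leq_trans lek; rewrite -[20%N]/(8 + 3 * 4)%N expnD leq_mul2l expnM.
    by rewrite leq_exp2r ?leC ?orbT.
  apply: le_trans (pr_union leP) _.
  by rewrite ler_wpM2r ?exprn_ge0 // -natrX ler_nat.
have leP u : u \in V ->
    pr (fun f => [forall i in sumset u.1 u.2, f i != t0]) <= p ^+ (k ^ 2).
  by rewrite inE => /and3P[_ _]; apply: pr_supp.
apply: le_trans (pr_union leP) _.
by rewrite ler_wpM2r ?exprn_ge0 ?(ltW pnz_gt0) // -natrX ler_nat.
Qed.

End RandomSupport.

(** * Geometric decay beats polynomial growth *)

Section PolynomialTimesGeometric.
Variable R : realType.
Local Open Scope ring_scope.

(** Each of the [k.+1] terms of the geometric sum up to [s ^ k] is at least [s ^ k], and the sum is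
    at most [(1 - s)^-1]. *)
Lemma natrM_geometric_le (s : R) (k : nat) : 0 <= s -> s < 1 ->
  k.+1%:R * s ^+ k <= (1 - s)^-1.
Proof.
move=> s0 s1; have s1' : 0 < 1 - s by rewrite subr_gt0.
rewrite -[leRHS]mul1r ler_pdivlMr // mulrC.
apply: (@le_trans _ _ ((1 - s) * \sum_(i < k.+1) s ^+ i)).
  apply: ler_wpM2l; first exact: ltW.
  rewrite mulr_natl -[k.+1 in leLHS]card_ord -sumr_const.
  by apply: ler_sum => i _; rewrite ler_wiXn2l ?(ltW s1) // -ltnS.
by rewrite -[leLHS]opprK -mulNr opprB -subrX1 opprB gerBl exprn_ge0.
Qed.

Lemma cvg_natX_geometric (m : nat) (r : R) : 0 < r -> r < 1 ->
  ((fun k : nat => k.+1%:R ^+ m * r ^+ k : R) @ \oo --> (0 : R))%classic.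
Proof.
(* With [s] the root of [r] of order [m.+1], [m] of the factors [s ^ k] each keep one factor [k.+1]
   bounded; the remaining one tends to 0. *)
move=> r0 r1; pose s : R := r `^ m.+1%:R^-1.
have s0 : 0 <= s by exact: powR_ge0.
have sE : s ^+ m.+1 = r.
  by rewrite -powR_mulrn // -powRrM mulVf ?pnatr_eq0 // powRr1 // ltW.
have s1 : s < 1.
  by rewrite ltNge; apply/negP => /(exprn_ege1 m.+1); rewrite sE leNgt r1.
pose M := (1 - s)^-1 ^+ m.
apply: (@squeeze_cvgr _ _ _ _ (fun=> 0) (fun k => M * s ^+ k)).
- apply: nearW => k; rewrite mulr_ge0 ?exprn_ge0 ?(ltW r0) //=.
  rewrite -sE exprS exprMn [s ^+ k * _]mulrC mulrA ler_wpM2r ?exprn_ge0 //.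
  rewrite -exprM mulnC exprM -exprMn.
  rewrite lerXn2r ?nnegrE ?mulr_ge0 ?exprn_ge0 ?invr_ge0 ?subr_ge0 ?(ltW s1) //.
  exact: natrM_geometric_le.
- exact: cvg_cst.
- by rewrite -(mulr0 M); apply: cvgMl_tmp; apply: cvg_expr; rewrite ger0_norm.
Qed.

Lemma near_natX_geometric_le (m : nat) (r e : R) : 0 < r -> r < 1 -> 0 < e ->
  (\forall k \near \oo, k.+1%:R ^+ m * r ^+ k <= e)%classic.
Proof.
move=> r0 r1 e0.
have /cvgr0Pnorm_le/(_ e e0) := cvg_natX_geometric m r0 r1.
by apply: filterS => k; apply: le_trans (ler_norm _).
Qed.

End PolynomialTimesGeometric.

(** * Decomposability has vanishing probability *)

Lemma root_bounds (m N : nat) : (0 < m)%N ->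
  exists k, (k ^ m <= N < k.+1 ^ m)%N.
Proof.
move=> m0; have ex0 : exists k, (k ^ m <= N)%N by exists 0%N; rewrite exp0n.
have bd k : (k ^ m <= N)%N -> (k <= N)%N.
  apply: leq_trans; case: k => // k; rewrite -[leqLHS]expn1 leq_pexp2l //.
case: (ex_maxnP ex0 bd) => k lek maxk; exists k; rewrite lek ltnNge.
by apply/negP => /maxk; rewrite ltnn.
Qed.

Section Limit.
Variables (R : realType) (T : finType) (t0 : T).
Hypothesis T_gt1 : (1 < #|T|)%N.
Local Open Scope ring_scope.
Local Notation p := (pnz R t0).

(** From size [s0] on, [pr_tiled_le] gives [1 - p / 2]; below [s0], the bound of [pr_tiled_le_small]
    is at most its value at [s0]. *)
Lemma pr_tiled_le_unif : exists y : R, [/\ 0 < y, y < 1 &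
  forall n (C : {set 'I_n.+1}) a, (1 < #|C|)%N -> pr R (tiled t0 C a) <= y].
Proof.
have p0 := pnz_gt0 R t0 T_gt1; have p1 := pnz_lt1 R t0 T_gt1.
have q0 : 0 < 1 - p by rewrite subr_gt0.
have [s0 _ hs0] := near_natX_geometric_le 1 p0 p1 (divr_gt0 p0 (ltr0n R 2)).
pose y1 := 1 - p / 2%:R; pose y2 := 1 - p * (1 - p) ^+ (s0 ^ 2).
exists (Num.max y1 y2); split.
- by rewrite lt_max /y1; apply/orP; left; lra.
- rewrite gt_max /y1 /y2 !gtrBl; apply/andP; split; first by rewrite divr_gt0.
  by rewrite mulr_gt0 ?exprn_gt0.
move=> n C a C1; rewrite le_max; case: (leqP s0 #|C|) => leC; apply/orP.
  left; apply: le_trans (pr_tiled_le R t0 T_gt1 C a) _.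
  have := hs0 _ leC; rewrite /= expr1 /y1 -natr1 mulrDl mul1r.
  have : 0 <= p ^+ #|C| by rewrite exprn_ge0 ?ltW.
  by lra.
right; apply: le_trans (pr_tiled_le_small R t0 T_gt1 a C1) _.
rewrite lerD2l lerN2 ler_wpM2l ?(ltW p0) // ler_wiXn2l ?(ltW q0) //.
  by rewrite gerBl ltW.
by rewrite leq_sqr ltnW.
Qed.

(** Take [k] with [k ^ 20 <= n.+1 < k.+1 ^ 20]. The two terms of [pr_decomposable_le] are then at
    most [(k.+1 ^ 20 * y ^ k) ^ (k ^ 3)] and [(k.+1 ^ 40 * p ^ k) ^ k], whose bases tend to 0. *)
Lemma near_pr_decomposable_le (e : R) : 0 < e ->
  (\forall n \near \oo, pr R (@decomposable T t0 n) <= e)%classic.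
Proof.
(* With [e <= 1], raising a base in the interval from 0 to [e / 2] to a positive power does not
   increase it. *)
wlog e1 : e / e <= 1 => [hw e0|e0].
  case: (leP e 1) => [/hw/(_ e0)//|/ltW e1].
  by apply: filterS (hw 1 (lexx 1) ltr01) => n /le_trans; apply.
have p0 := pnz_gt0 R t0 T_gt1; have p1 := pnz_lt1 R t0 T_gt1.
have [y [y0 y1 hy]] := pr_tiled_le_unif.
have e20 : 0 < e / 2%:R by rewrite divr_gt0.
have [K1 _ hK1] := near_natX_geometric_le 20 y0 y1 e20.
have [K2 _ hK2] := near_natX_geometric_le 40 p0 p1 e20.
pose K := maxn 1 (maxn K1 K2).
exists (K ^ 20)%N => // n /= leKn.
have [k /andP[lek ltk]] := @root_bounds 20 n.+1 isT.
have leKk : (K <= k)%N.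
  rewrite -ltnS -(ltn_exp2r _ _ (isT : (0 < 20)%N)) (leq_ltn_trans _ ltk) //.
  exact: leqW.
have [k0 leK1 leK2] : [/\ (0 < k)%N, (K1 <= k)%N & (K2 <= k)%N].
  by move: leKk; rewrite !geq_max => /and3P.
apply: le_trans (pr_decomposable_le T_gt1 k0 lek (ltW y0) (@hy n)) _.
have leN : n.+1%:R <= k.+1%:R ^+ 20 :> R by rewrite -natrX ler_nat ltnW.
have le_eX (m : nat) (x : R) :
    (0 < m)%N -> 0 <= x -> x <= e / 2%:R -> x ^+ m <= e / 2%:R.
  case: m => // m _ x0 xe; apply: (le_trans _ xe).
  by apply: ler_iXnr => //; apply: le_trans xe _; lra.
have -> : e = e / 2%:R + e / 2%:R by lra.
apply: lerD.
  apply: le_trans (le_eX (k ^ 3)%N _ _ _ (hK1 k leK1)); last 2 first.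
  - by rewrite expn_gt0 k0.
  - by rewrite mulr_ge0 // exprn_ge0 // ltW.
  rewrite exprMn ler_pM ?exprn_ge0 ?(ltW y0) //.
    by rewrite lerXn2r ?nnegrE ?exprn_ge0.
  (* The exponent [k * k ^ 3] is at most [k ^ 8]. *)
  by rewrite -exprM -expnS ler_wiXn2l ?(ltW y0) ?(ltW y1) // leq_pexp2l.
apply: le_trans (le_eX k _ _ _ (hK2 k leK2)) => //; last first.
  by rewrite mulr_ge0 // exprn_ge0 // ltW.
rewrite [leRHS]exprMn ler_pM ?exprn_ge0 ?(ltW p0) //.
  rewrite -[40%N]/(20 * 2)%N exprM -[leRHS]exprM mul2n -addnn.
  by rewrite lerXn2r ?nnegrE ?exprn_ge0.
by rewrite -exprM mulnn.
Qed.

End Limit.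

(** * Supports of products over the max-min semiring *)

Section MaxMin.
Local Open Scope ring_scope.
Implicit Types (a c : maxmin) (g h : fps).

Lemma maxmin_add_eq0 a c : (a + c == 0) = (a == 0) && (c == 0).
Proof.
case: a c => [m|] [k|] //=; last by rewrite andbF.
rewrite -[LHS]/(maxn m k == 0)%N -[RHS]/((m == 0) && (k == 0))%N.
by case: m k => [|m] [|k]; rewrite ?maxnSS ?max0n ?maxn0.
Qed.

Lemma maxmin_mul_eq0 a c : (a * c == 0) = (a == 0) || (c == 0).
Proof.
case: a c => [m|] [k|] //=; last by rewrite orbF.
rewrite -[LHS]/(minn m k == 0)%N -[RHS]/((m == 0) || (k == 0))%N.
by case: m k => [|m] [|k]; rewrite ?minnSS ?min0n ?minn0.
Qed.

(** A maximum cannot cancel and a minimum of nonzero elements is nonzero, so the support of a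
    product is the sumset of the supports. *)
Lemma mul_fps_neq0 g h x : reflect
  (exists i j, [/\ x = (i + j)%N, g i != 0 & h j != 0]) (mul_fps g h x != 0).
Proof.
rewrite /mul_fps (big_morph (fun a => a == 0) maxmin_add_eq0 (eqxx _)) big_andE.
rewrite negb_forall; apply: (iffP existsP) => [[i]|[i [j [-> gi hj]]]].
  rewrite maxmin_mul_eq0 negb_or => /andP[gi hj]; exists i, (x - i)%N.
  by rewrite subnKC // -ltnS.
have lt : (i < (i + j).+1)%N by rewrite ltnS leq_addr.
by exists (Ordinal lt); rewrite /= addKn maxmin_mul_eq0 negb_or gi.
Qed.

Lemma not_monomial g : ~ monomial g ->
  exists i j, [/\ i != j, g i != 0 & g j != 0].
Proof.
move=> mg; apply: contrapT => ng; apply: mg.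
have [[i gi]|g0] := pselect (exists i, g i != 0); last first.
  exists 0, 0%N; apply/funext => i; rewrite if_same; apply/eqP.
  by apply/negPn/negP => gi; apply: g0; exists i.
exists (g i), i; apply/funext => j; case: eqP => [->//|/eqP ji].
by apply/eqP/negPn/negP => gj; apply: ng; exists j, i.
Qed.

End MaxMin.

(** * Polynomials as coefficient functions *)

Section PolynomialsOfDegree.
Variables b' n : nat.
Local Notation b := b'.+2.
Local Notation F := {ffun 'I_n.+1 -> 'I_b}.
Local Open Scope ring_scope.
Implicit Types f : F.

Definition poly_of_coefs f : {poly maxmin} :=
  \poly_(i < n.+1) Fin (f (inord i)).

Lemma coef_neq0_supp f (i : nat) :
  ((poly_of_coefs f)`_i != 0) = in_supp ord0 f i.
Proof. by rewrite coef_poly /in_supp; case: ltnP => // _; rewrite eqxx. Qed.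

Lemma poly_of_coefs_inj : injective poly_of_coefs.
Proof.
move=> f g /polyP e; apply/ffunP => i; apply/val_inj.
by have := e i; rewrite !coef_poly ltn_ord inord_val => -[].
Qed.

Lemma polys_of_degreeP (u : {poly maxmin}) : polys_of_degree b n u <->
  exists2 f : F, f ord_max != ord0 & u = poly_of_coefs f.
Proof.
split=> [[uB su]|[f fn ->]].
  have lt_b (j : 'I_n.+1) : (odflt 0%N (option_of_maxmin (u`_j)%R) < b)%N.
    by have := uB j; rewrite unfold_in /Bset; case: (u`_j).
  pose f : F := [ffun j => Ordinal (lt_b j)].
  have e : u = poly_of_coefs f.
    apply/polyP => i; rewrite coef_poly; case: ltnP => [lt_i|le_i]; last first.
      by rewrite nth_default // su.
    rewrite ffunE /= inordK //.
    by have := uB i; rewrite unfold_in /Bset; case: (u`_i).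
  exists f => //.
  have : lead_coef u != 0 by rewrite lead_coef_eq0 -size_poly_eq0 su.
  rewrite lead_coefE su e coef_neq0_supp /in_supp ltnSn /=.
  by rewrite -[inord n]/(inord (@ord_max n)) inord_val.
split=> [i|].
  by rewrite coef_poly; case: ifP => // _; rewrite unfold_in /= ltn_ord.
rewrite size_poly_eq // -[inord _]/(inord (@ord_max n)) inord_val.
exact: fn.
Qed.

(** Injectivity of [poly_of_coefs] carries the count over to the probability space; [Q] covers both
    numerator and denominator. *)
Lemma card_polys_of_degree (Q : {poly maxmin} -> Prop) :
  #|` fset_set [set u | polys_of_degree b n u /\ Q u]%classic| =
  #|[pred f : F | (f ord_max != ord0) && `[< Q (poly_of_coefs f) >]]|.
Proof.
set P := [pred f : F | _].
have -> : fset_set [set u | polys_of_degree b n u /\ Q u]%classic =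
    [fset poly_of_coefs f | f in P]%fset.
  apply/fsetP => u; rewrite in_fset_set; last first.
    by apply: sub_finite_set (finite_polys_of_degree b n) => v [].
  apply/idP/imfsetP => [|[f /andP[fn /asboolP Qf] ->]].
    rewrite inE => -[/polys_of_degreeP[f fn ->] Qf]; exists f => //.
    by rewrite inE /= fn; apply/asboolP.
  by rewrite inE; split=> //; apply/polys_of_degreeP; exists f.
by rewrite card_imfset /= -?cardE //; apply: poly_of_coefs_inj.
Qed.

(** The supports of the two factors provide the decomposition: neither factor is a monomial, so each
    support has two elements. *)
Lemma reducible_decomposable f :
  ~ fps_irreducible (fps_of_poly (poly_of_coefs f)) -> decomposable ord0 f.
Proof.
move=> red; have [g [h [e mg mh]]] : exists g h,
    [/\ fps_of_poly (poly_of_coefs f) = mul_fps g h,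
        ~ monomial g & ~ monomial h].
  apply: contrapT => ne; apply: red => g h e.
  apply: contrapT => /not_orP[mg mh]; apply: ne; by exists g, h.
have sE x : reflect (exists i j, [/\ x = (i + j)%N, g i != 0 & h j != 0])
    (in_supp ord0 f x).
  rewrite -coef_neq0_supp -[_`_x]/(fps_of_poly (poly_of_coefs f) x) e.
  exact: mul_fps_neq0.
have [i1 [i2 [i12 gi1 gi2]]] := not_monomial mg.
have [j1 [j2 [j12 hj1 hj2]]] := not_monomial mh.
(* The factors are power series, but adding a support element of the other factor lands in the
   support of [f], hence at most [n]. *)
have ltg i : g i != 0 -> (i < n.+1)%N.
  move=> gi.
  have /andP[lt _] : in_supp ord0 f (i + j1) by apply/sE; exists i, j1.
  by apply: leq_ltn_trans lt; apply: leq_addr.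
have lth j : h j != 0 -> (j < n.+1)%N.
  move=> hj.
  have /andP[lt _] : in_supp ord0 f (i1 + j) by apply/sE; exists i1, j.
  by apply: leq_ltn_trans lt; apply: leq_addl.
apply/existsP; exists [set i : 'I_n.+1 | g i != 0]%SET.
apply/existsP; exists [set j : 'I_n.+1 | h j != 0]%SET.
apply/and3P; split.
- apply/card_gt1P; exists (Ordinal (ltg _ gi1)), (Ordinal (ltg _ gi2)).
  by rewrite !inE -val_eqE.
- apply/card_gt1P; exists (Ordinal (lth _ hj1)), (Ordinal (lth _ hj2)).
  by rewrite !inE -val_eqE.
apply/supp_sumsetP; split=> [i j|x fx].
  by rewrite !inE => gi hj; apply/sE; exists i, j.
have /sE[i [j [xE gi hj]]] : in_supp ord0 f x.
  by rewrite /in_supp ltn_ord inord_val.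
by exists (Ordinal (ltg _ gi)), (Ordinal (lth _ hj)); rewrite !inE.
Qed.

End PolynomialsOfDegree.

(** * Passage to the limiting proportion *)

Local Open Scope classical_set_scope.
Local Open Scope ring_scope.

Theorem theorem1p8 (R : realType) (b : nat) (hb : (2 <= b)%N) :
  (fun n : nat =>
     (#|` fset_set (irreducible_polys_of_degree b n)|)%:R
       / (#|` fset_set (polys_of_degree b n)|)%:R : R) @ \oo --> (1 : R).
Proof.
case: b hb => [|[|b]] // _.
have T1 : (1 < #|'I_b.+2|)%N by rewrite card_ord.
have p0 := pnz_gt0 R ord0 T1.
apply/cvgrPdist_le => e e0.
(* Degree exactly [n] requires a nonzero leading coefficient, an event of probability [p]; the
   tolerance [p * e] compensates for dividing by it. *)
apply: filterS (near_pr_decomposable_le ord0 T1 (mulr_gt0 p0 e0)) => n le_e.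
set p := pnz R (ord0 : 'I_b.+2) in p0 le_e.
rewrite (card_polys_of_degree _ _ (fun u => fps_irreducible (fps_of_poly u))).
have -> : polys_of_degree b.+2 n = [set u | polys_of_degree b.+2 n u /\ True].
  by apply/funext => u; apply/propext; split=> [|[]].
rewrite (card_polys_of_degree _ _ (fun=> True)).
set A := #|_|; set B := #|_|.
pose F := {ffun 'I_n.+1 -> 'I_b.+2}.
have N0 := card_ffun_gt0 R 'I_n.+1 (ord0 : 'I_b.+2).
have BE : B%:R = p * #|{: F}|%:R :> R.
  have -> : p = pr R (fun f : F => ~~ (f ord_max == ord0)).
    by rewrite (prC _ ord0) pr_coord0 // subKr.
  rewrite /pr divfK ?gt_eqF //; congr _%:R; apply: eq_card => f.
  by rewrite !inE asboolT // andbT.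
have leAB : (A <= B)%N.
  apply/subset_leq_card/fintype.subsetP => f; rewrite !inE => /andP[-> _].
  exact: asboolT.
(* Every polynomial of degree [n] that is not irreducible is decomposable. *)
have leBA : B%:R - A%:R <=
    pr R (@decomposable _ (ord0 : 'I_b.+2) n) * #|{: F}|%:R :> R.
  rewrite /pr divfK ?gt_eqF // lerBlDl -natrD ler_nat.
  rewrite /A -cardUI; apply: leq_trans (leq_addr _ _).
  apply/subset_leq_card/fintype.subsetP => f; rewrite !inE => /andP[-> _] /=.
  by case: asboolP => //= /reducible_decomposable.
have B0 : 0 < B%:R :> R by rewrite BE mulr_gt0.
rewrite ger0_norm ?subr_ge0 ?ler_pdivrMr ?mul1r ?ler_nat //.
rewrite -[X in X - _](divff (lt0r_neq0 B0)) -mulrBl ler_pdivrMr //.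
apply: le_trans leBA _; rewrite BE mulrA ler_wpM2r ?(ltW N0) // mulrC.
exact: le_e.
Qed.
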